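(* Assume that $(X,T)$ is a transitive topological dynamical system and that $d\geq 1$ is an integer. If the regionally proximal relation of order $d$ on $X$ is trivial (i.e. $(x,y)\in\mathbf{RP}^{[d]}(X)$ implies $x=y$), then the system $(X,T)$ is distal.
   Context: A topological dynamical system $(X,T)$ is a compact metric space $X$ (with metric $d(\cdot,\cdot)$) and a homeomorphism $T:X\to X$. It is transitive if some point has dense orbit $\{T^nx:n\in\mathbb{Z}\}$. It is distal if $\inf_{n\in\mathbb{Z}}d(T^nx,T^ny)>0$ for all distinct $x,y\in X$. Write $[d]=\{1,\ldots,d\}$ and for $\mathbf{n}=(n_1,\ldots,n_d)\in\mathbb{Z}^d$ and $\epsilon\subset[d]$ put $\mathbf{n}\cdot\epsilon=\sum_{i\in\epsilon}n_i$. Points $x,y\in X$ are regionally proximal of order $d$, written $(x,y)\in\mathbf{RP}^{[d]}(X)$, if for any $\delta>0$ there exist $x',y'\in X$ and $\mathbf{n}\in\mathbb{Z}^d$ such that $d(x,x')<\delta$, $d(y,y')<\delta$ and $d(T^{\mathbf{n}\cdot\epsilon}x',T^{\mathbf{n}\cdot\epsilon}y')<\delta$ for every nonempty $\epsilon\subset[d]$. *)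

(* Defs.v *)
From HB Require Import structures.
From mathcomp Require Import all_boot all_order all_algebra.
From mathcomp Require Import all_classical all_reals all_analysis.

Set Implicit Arguments.
Unset Strict Implicit.
Unset Printing Implicit Defensive.

Import Order.TTheory GRing.Theory Num.Theory.

Local Open Scope classical_set_scope.
Local Open Scope ring_scope.

(* The inverse is part of the data, so that negative powers are explicit; it is
   uniquely determined by the underlying function. *)
Record homeo (X : topologicalType) := Homeo {
  homeo_fun :> X -> X ;
  homeo_inv : X -> X ;
  homeo_funK : cancel homeo_fun homeo_inv ;
  homeo_invK : cancel homeo_inv homeo_fun ;
  homeo_fun_continuous : continuous homeo_fun ;
  homeo_inv_continuous : continuous homeo_inv
}.

Section Dynamics.
Variables (R : realType) (X : metricType R) (T : homeo X).

(* [Negz k] is the integer - (k + 1). *)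
Definition iterz (n : int) : X -> X :=
  match n with
  | Posz k => iter k T
  | Negz k => iter k.+1 (homeo_inv T)
  end.

Definition int_orbit (x : X) : set X := [set iterz n x | n in [set: int]].

Definition transitive_system : Prop := exists x : X, dense (int_orbit x).

Definition distal : Prop :=
  forall x y : X, x <> y ->
    0 < inf [set mdist (iterz n x) (iterz n y) | n in [set: int]].

Definition face_sum (d : nat) (n : 'I_d -> int) (eps : {set 'I_d}) : int :=
  \sum_(i in eps) n i.

Definition RP (d : nat) : set (X * X) :=
  [set p | forall delta : R, 0 < delta ->
     exists (x' y' : X) (n : 'I_d -> int),
       [/\ mdist p.1 x' < delta,
           mdist p.2 y' < delta &
           forall eps : {set 'I_d}, eps != finset.set0 ->
             mdist (iterz (face_sum n eps) x') (iterz (face_sum n eps) y')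
               < delta]].

End Dynamics.

(* Main.v *)
Require Import Defs.
From mathcomp Require Import all_boot all_order all_algebra.
From mathcomp Require Import all_classical all_reals all_analysis.
From mathcomp Require Import lra zify.

(* If T^n x and T^n y come arbitrarily close, then by uniform continuity they
   stay close along arbitrarily long intervals of exponents: for each delta the
   set of n with d(T^n x, T^n y) < delta is thick. A thick set of integers
   contains all nonempty subsums of some n_1, ..., n_d, so (x, y) lies in
   RP^[d], witnessed by x' = x and y' = y. *)

Import Order.TTheory GRing.Theory Num.Theory.
Import numFieldNormedType.Exports.

Local Open Scope classical_set_scope.
Local Open Scope ring_scope.

(** The [n i] are chosen one index at a time: each new one is a shift that moves every subsum of the
    current [n] into [P]. *)
Lemma thick_subset_sums (I : finType) (P : int -> Prop) :
  (forall s : seq int, exists m, forall j, j \in s -> P (j + m)) ->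
  exists n : I -> int, forall eps : {set I}, eps != finset.set0 ->
    P (\sum_(i in eps) n i).
Proof.
move=> thickP.
(* Restricting [eps] to the indices of a list makes induction on that list possible. *)
suff [n Pn] : exists n : I -> int, forall eps : {set I}, eps != finset.set0 ->
    {subset eps <= enum I} -> P (\sum_(i in eps) n i).
  by exists n => eps eps0; apply: Pn => // i _; rewrite mem_enum.
elim: (enum I) => [|i s [n Pn]].
  exists (fun=> 0) => eps /set0Pn[i ieps] /(_ _ ieps).
  by rewrite in_nil.
(* The list includes the empty sum 0, so the singleton of the new index is covered as well: [m]
   itself satisfies [P]. *)
have [m Pm] := thickP [seq \sum_(k in eps) n k | eps : {set I}].
exists (fun k => if k == i then m else n k) => eps eps0 epss.
have [ieps|ieps] := boolP (i \in eps).
  rewrite (big_setD1 i)//= eqxx addrC.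
  rewrite (eq_bigr n) => [|k /setD1P[/negPf-> //]].
  by apply: Pm; apply: map_f; rewrite mem_enum.
rewrite (eq_bigr n) => [|k keps].
  apply: Pn => // k keps; have := epss k keps.
  by rewrite inE => /predU1P[ki|//]; rewrite ki (negPf ieps) in keps.
by case: eqP => // ki; rewrite ki (negPf ieps) in keps.
Qed.

Section Iterates.
Variables (R : realType) (X : metricType R) (T : homeo X).

Lemma iterz_continuous (n : int) : continuous (iterz T n).
Proof.
have iter_continuous (f : X -> X) k : continuous f -> continuous (iter k f).
  move=> fc; elim: k => [|k IHk] x; first exact: cvg_id.
  exact: continuous_comp (IHk x) (fc _).
case: n => k; apply: iter_continuous.
- exact: homeo_fun_continuous.
- exact: homeo_inv_continuous.
Qed.

Lemma iterzS (n : int) (x : X) : iterz T (1 + n) x = T (iterz T n x).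
Proof.
case: n => [//|[|k]]; first by rewrite /= homeo_invK.
by rewrite (_ : 1 + Negz k.+1 = Negz k); [rewrite /= homeo_invK|lia].
Qed.

Lemma iterzB1 (n : int) (x : X) : iterz T (n - 1) x = homeo_inv T (iterz T n x).
Proof. by rewrite -{2}(subrK 1 n) (addrC _ 1) iterzS homeo_funK. Qed.

Lemma iterzD (m n : int) (x : X) : iterz T (m + n) x = iterz T m (iterz T n x).
Proof.
elim/int_rect: m => [|m IHm|m IHm]; first by rewrite add0r.
- by rewrite intS -addrA !iterzS IHm.
- by rewrite intS opprD (addrC (-1)) addrAC !iterzB1 IHm.
Qed.

End Iterates.

Section Compact.
Variables (R : realType) (X : metricType R).
Hypothesis X_compact : compact [set: X].

(** Heine-Cantor: the near-covering form of compactness, applied to radii [e] tending to 0 from the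
    right, turns local moduli of continuity into a global one. *)
Lemma compact_mdist_unif_continuous (f : X -> X) (delta : R) :
  continuous f -> 0 < delta ->
  exists2 e : R, 0 < e &
    forall x y, mdist x y < e -> mdist (f x) (f y) < delta.
Proof.
move=> fc delta0.
have := X_compact; rewrite compact_near_coveringP.
move=> /(_ R (0^'+) (fun e x => forall y, mdist x y < e ->
  mdist (f x) (f y) < delta) _).
case=> [x _|r /= r0 rP].
  have d20 : 0 < delta / 2 by rewrite divr_gt0.
  have : \forall z \near x, ball (f x) (delta / 2) (f z).
    exact: (fc x) (nbhsx_ballx (f x) _ d20).
  move=> /nbhs_ballP[r /= r0 rP].
  have r20 : 0 < r / 2 by rewrite divr_gt0.
  (* With both radii halved, [z] and [y] lie within [r] of [x], so [f z] and [f y] are each within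
     [delta / 2] of [f x]. *)
  exists (ball x (r / 2), [set e | e < r / 2]) => /=.
    by split; [exact: nbhsx_ballx|exact: nbhs_right_lt].
  move=> [z e] /= [xz er] y zy.
  rewrite ballEmdist /= in xz.
  have xy_lt : mdist x y < r by have := metric_triangle x z y; lra.
  have fxz : mdist (f x) (f z) < delta / 2.
    by have := rP z; rewrite !ballEmdist; apply; rewrite /=; lra.
  have fxy : mdist (f x) (f y) < delta / 2.
    by have := rP y; rewrite !ballEmdist; apply.
  have := metric_triangle (f z) (f x) (f y).
  rewrite (metric_sym (f z) (f x)); lra.
(* Here [r] is the size of a right neighbourhood of 0 in which every [e] is a modulus. *)
exists (r / 2); first by rewrite divr_gt0.
move=> x y; apply: (rP (r / 2)) => //=; last by rewrite divr_gt0.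
rewrite sub0r normrN gtr0_norm ?divr_gt0//; lra.
Qed.

Lemma compact_iterz_equicontinuous (T : homeo X) (s : seq int) (delta : R) :
  0 < delta ->
  exists2 e : R, 0 < e & forall x y, mdist x y < e ->
    forall j, j \in s -> mdist (iterz T j x) (iterz T j y) < delta.
Proof.
move=> delta0; elim: s => [|j s [e e0 eP]]; first by exists 1.
have [e' e'0 e'P] :=
  @compact_mdist_unif_continuous _ _ (iterz_continuous _ _ T j) delta0.
exists (Num.min e e'); first by rewrite lt_min e0.
move=> x y; rewrite lt_min => /andP[xe xe'] k.
by rewrite inE => /predU1P[->|]; [exact: e'P|exact: eP].
Qed.

Lemma proximal_RP (T : homeo X) (d : nat) (x y : X) :
  (forall e : R, 0 < e -> exists n, mdist (iterz T n x) (iterz T n y) < e) ->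
  RP T d (x, y).
Proof.
move=> prox delta delta0 /=.
have [s|n nP] := @thick_subset_sums 'I_d
    (fun n => mdist (iterz T n x) (iterz T n y) < delta).
  (* The modulus [e] depends only on [s] and [delta], so it can be fixed before the time [m] at
     which the orbits are [e]-close. *)
  have [e e0 eP] := compact_iterz_equicontinuous T s _ delta0.
  have [m xym] := prox e e0.
  by exists m => j js; rewrite !iterzD; exact: eP.
by exists x, y, n; rewrite !mdistxx.
Qed.

End Compact.

Theorem proposition1p1 (R : realType) (X : metricType R) (T : homeo X) (d : nat)
  (X_compact : compact [set: X])
  (T_transitive : transitive_system T)
  (d_ge1 : (1 <= d)%N)
  (RP_trivial : forall x y : X, RP T d (x, y) -> x = y) :
  distal T.
Proof.
move=> x y xy; rewrite ltNge; apply/negP => inf_le0.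
apply/xy/RP_trivial/(proximal_RP _ _ X_compact) => e e0.
(* Some distance lies below [inf + e], hence below [e] since the infimum is at most 0. The side goal
   asks that the set be nonempty (witness at time 0) and bounded below. *)
have [|_ [n _ <-] ne] := inf_adherent e0 (E :=
    [set mdist (iterz T n x) (iterz T n y) | n in [set: int]]).
  split; first by exists (mdist x y), 0.
  by exists 0 => _ [n _ <-]; exact: mdist_ge0.
by exists n; apply: lt_le_trans ne _; rewrite gerDr.
Qed.
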